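(* Let $S$ and $T$ be semigroups with $[S]\cong[T]$. If either $S$ or $T$ has a right identity, a left identity, or a two-sided identity, then $S\cong T$.
   Context: For a semigroup $S$, $[S]$ denotes the set $S$ with its natural ternary operation $[abc]=(ab)c$. $[S]\cong[T]$ means that there is a bijection $\delta:S\to T$ with $\delta[abc]=[(\delta a)(\delta b)(\delta c)]$ for all $a,b,c\in S$. *)

(* Defs.v *)
From HB Require Import structures.
From mathcomp Require Import all_boot.

Set Implicit Arguments.
Unset Strict Implicit.
Unset Printing Implicit Defensive.

Local Open Scope group_scope.

(* The library's semigroupType bundles a choice structure on the carrier, which
   a bare semigroup does not have; hence this predicate on magmas. *)
Definition is_semigroup (S : magmaType) : Prop := associative (@mul S).

(* The ternary operation [abc] of [S]. *)
Definition ternary (S : magmaType) (a b c : S) : S := (a * b) * c.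

Definition ternary_isomorphic (S T : magmaType) : Prop :=
  exists2 delta : S -> T, bijective delta &
    forall a b c : S,
      delta (ternary a b c) = ternary (delta a) (delta b) (delta c).

Definition isomorphic (S T : magmaType) : Prop :=
  exists delta : {multiplicative S -> T}, bijective delta.

Definition has_right_identity (S : magmaType) : Prop :=
  exists e : S, right_id e (@mul S).

Definition has_left_identity (S : magmaType) : Prop :=
  exists e : S, left_id e (@mul S).

Definition has_identity (S : magmaType) : Prop :=
  exists e : S, left_id e (@mul S) /\ right_id e (@mul S).

(* Main.v *)
(** If [e] is a right identity of [S] and [f := delta e], then [t f f = t] for
    all [t] in [T], and [delta (x y) = delta [x e y] = delta x f delta y]. So
    [x |-> delta x * f] is multiplicative, and it is bijective because right
    multiplication by [f] is an involution of [T]. Left identities are dual. *)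
Require Import Defs.
From HB Require Import structures.
From mathcomp Require Import all_boot.

Set Implicit Arguments.
Unset Strict Implicit.
Unset Printing Implicit Defensive.

Local Open Scope group_scope.

(** Bridge from bare functions to the bundled morphisms over which [isomorphic] quantifies. *)
Lemma isomorphic_of_morphism (S T : magmaType) (phi : S -> T) :
  {morph phi : x y / x * y} -> bijective phi -> isomorphic S T.
Proof.
move=> phiM bij_phi.
pose mixin := isMultiplicative.Build S T phi phiM.
pose phi' : {multiplicative S -> T} := HB.pack phi mixin.
by exists phi'.
Qed.

Lemma isomorphic_sym (S T : magmaType) : isomorphic S T -> isomorphic T S.
Proof.
case=> phi [psi phiK psiK].
apply: (@isomorphic_of_morphism _ _ psi); last by exists phi.
by move=> x y; apply: (can_inj phiK); rewrite gmulfM !psiK.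
Qed.

Lemma ternary_isomorphic_sym (S T : magmaType) :
  ternary_isomorphic S T -> ternary_isomorphic T S.
Proof.
case=> delta [psi deltaK psiK] deltaM.
exists psi; first by exists delta.
by move=> a b c; apply: (can_inj deltaK); rewrite deltaM !psiK.
Qed.

Lemma isomorphic_of_right_identity (S T : magmaType) :
  is_semigroup T -> ternary_isomorphic S T -> has_right_identity S ->
  isomorphic S T.
Proof.
move=> mulTA [delta bij_delta deltaM] [e mulxe].
have mulff : involutive (fun t : T => t * delta e).
  have [psi _ psiK] := bij_delta.
  (* Write [t] as [delta s] with [s := psi t]: then [t * delta e * delta e] is, up to unfolding
     [ternary], the image of [[s e e] = s]. *)
  by move=> t; rewrite -(psiK t) -[LHS]deltaM /ternary !mulxe.
apply: (@isomorphic_of_morphism _ _ (fun x => delta x * delta e)).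
  by move=> x y; rewrite -{1}(mulxe x) [delta _]deltaM /ternary !mulTA.
exact: bij_comp (inv_bij mulff) bij_delta.
Qed.

Lemma isomorphic_of_left_identity (S T : magmaType) :
  is_semigroup S -> is_semigroup T -> ternary_isomorphic S T ->
  has_left_identity S -> isomorphic S T.
Proof.
move=> mulSA mulTA [delta bij_delta deltaM] [e mulex].
have mulff : involutive (fun t : T => delta e * t).
  have [psi _ psiK] := bij_delta.
  by move=> t; rewrite -(psiK t) mulTA -[LHS]deltaM /ternary !mulex.
apply: (@isomorphic_of_morphism _ _ (fun x => delta e * delta x)).
  (* Here [e] is inserted to the left of [y], so [x * (e * y)] must be reassociated in [S] to become
     the left-bracketed [[x e y]]. *)
  by move=> x y; rewrite -{1}(mulex y) mulSA [delta (_ * _)]deltaM /ternary !mulTA.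
exact: bij_comp (inv_bij mulff) bij_delta.
Qed.

Theorem corollary14 (S T : magmaType)
  (semiS : is_semigroup S) (semiT : is_semigroup T)
  (isoST : ternary_isomorphic S T)
  (hid : (has_right_identity S \/ has_right_identity T) \/
         (has_left_identity S \/ has_left_identity T) \/
         (has_identity S \/ has_identity T)) :
  isomorphic S T.
Proof.
have isoTS := ternary_isomorphic_sym isoST.
have rightS := isomorphic_of_right_identity semiT isoST.
(* For an identity in [T], the roles of [S] and [T] are exchanged and the resulting isomorphism is
   inverted. *)
have rightT idT := isomorphic_sym (isomorphic_of_right_identity semiS isoTS idT).
have leftS := isomorphic_of_left_identity semiS semiT isoST.
have leftT idT :=
  isomorphic_sym (isomorphic_of_left_identity semiT semiS isoTS idT).
case: hid => [[/rightS|/rightT] //|[[/leftS|/leftT] //|]].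
(* A two-sided identity is used through its right half. *)
by case=> -[e [_ mulxe]]; [apply: rightS|apply: rightT]; exists e.
Qed.
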